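(* Let $n\ge2$, $I\in\mathcal I_n$, $\Sigma=(\sigma_\nu)_{\nu=0}^{n-2},\ \tilde\Sigma=(\tilde\sigma_\nu)_{\nu=0}^{n-2}\in\Sigma_I$, $F=\mathscr F_I(\Sigma)$, $\tilde F=\mathscr F_I(\tilde\Sigma)$, and suppose that a unit lower-triangular matrix function $P(x)=[p_{k,j}(x)]_{k,j=1}^n$ (with entries locally absolutely continuous on $\mathbb R_+$) satisfies the equation $$P'(x)+P(x)\tilde F(x)=F(x)P(x),\quad x\in\mathbb R_+.$$ Then $P(x)$ identically equals the $n\times n$ unit matrix $I_n$ on $\mathbb R_+$ and $\Sigma=\tilde\Sigma$, that is, $\sigma_\nu(x)=\tilde\sigma_\nu(x)$ a.e. on $\mathbb R_+$, $\nu=0,\dots,n-2$.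
   Context: Notation: $\mathbb R_+=(0,\infty)$; $n=2m+\tau$ with $m\in\mathbb N$, $\tau\in\{0,1\}$; $C_i^s=\frac{i!}{s!(i-s)!}$ are the binomial coefficients, with $C_i^{-1}:=0$. Unit lower-triangular means lower-triangular with ones on the diagonal. The equation for $P$ is understood a.e. on $\mathbb R_+$. Singularity orders: $\mathcal I_n$ is the set of integer sequences $I=(i_\nu)_{\nu=0}^{n-2}$ with $0\le i_{2k}\le m-k$ for $k=0,\dots,m-1$ and $0\le i_{2k+1}\le m-k-1$ for $k=0,\dots,m+\tau-2$. The set $K(I)\subseteq\{0,\dots,n-2\}$: if $n=2m+1$, then $K(I)=\varnothing$; if $n=2m$, then $2k\in K(I)\Leftrightarrow i_{2k}=m-k$, and $2k+1\in K(I)\Leftrightarrow i_{2k+1}=m-k-1$. Coefficients: $\Sigma_I$ is the set of $\Sigma=(\sigma_\nu)_{\nu=0}^{n-2}$ with $\sigma_\nu\in L_1(\mathbb R_+)$ for all $\nu$ and, in addition, $\sigma_\nu\in L_2(\mathbb R_+)$ for $\nu\in K(I)$. Matrix $Q$: $\mathscr Q_I(\Sigma)=[q_{r,j}]_{r,j=0}^m:=\sum_{\nu=0}^{n-2}\sigma_\nu(x)\chi_{\nu,i_\nu}$, where the constant matrices $\chi_{\nu,i}=[\chi_{\nu,i;r,j}]_{r,j=0}^m$ have entries $\chi_{2k,i;s+k,i-s+k}=C_i^s$ $(s=0,\dots,i)$, $\chi_{2k+1,i;s+k,i+1-s+k}=C_{i+1}^s-2C_i^{s-1}$ $(s=0,\dots,i+1)$,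 and all other entries zero. Matrix $F$: $\mathscr F_I(\Sigma)=\mathscr S_n(\mathscr Q_I(\Sigma))$, where $F=[f_{k,j}]_{k,j=1}^n=\mathscr S_n(Q)$ is given as follows. If $n=2m$: $f_{m,j}=(-1)^{m+1}q_{j-1,m}$ for $1\le j\le m$; $f_{k,m+1}=(-1)^{k+1}q_{m,2m-k}$ for $m+1\le k\le 2m$; $f_{k,j}=(-1)^{k+1}q_{j-1,2m-k}+(-1)^{m+k}q_{j-1,m}q_{m,2m-k}$ for $m+1\le k\le 2m$, $1\le j\le m$. If $n=2m+1$: $f_{k,j}=(-1)^kq_{j-1,2m+1-k}$ for $m+1\le k\le 2m+1$, $1\le j\le m+1$. In both cases $f_{k,k+1}=1$ for $k=1,\dots,n-1$, and all remaining entries are zero. *)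

(* Defs.v *)
From HB Require Import structures.
From mathcomp Require Import all_boot all_order all_algebra.
From mathcomp Require Import complex.
From mathcomp Require Import all_classical all_reals all_analysis.

Set Implicit Arguments.
Unset Strict Implicit.
Unset Printing Implicit Defensive.

Import Order.TTheory GRing.Theory Num.Theory.
Import numFieldNormedType.Exports.
Import ComplexField.Normc.

Local Open Scope classical_set_scope.
Local Open Scope ring_scope.
Local Open Scope complex_scope.

(* Functions on the half-line (0, +oo) are represented by functions on R;
   only their values at positive points are ever used.  Coefficients and
   solutions are complex-valued.  Throughout n = 2m + tau with m = n./2 and
   tau = odd n, and a sequence indexed by 0, ..., n-2 is indexed by 'I_n.-1. *)

Section FunctionSpaces.
Variable R : realType.

Definition in_Lp_Rplus (p : nat) (f : R -> R[i]) : Prop :=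
  [/\ measurable_fun (`]0, +oo[ : set R) (fun x : R => complex.Re (f x)),
      measurable_fun (`]0, +oo[ : set R) (fun x : R => complex.Im (f x)) &
      (\int[lebesgue_measure]_(x in (`]0%R, +oo[%classic : set R))
         ((normc (f x)) ^+ p)%:E < +oo)%E].

Definition abs_continuous_on (c d : R) (f : R -> R[i]) : Prop :=
  forall e : R, 0 < e -> exists2 delta : R, 0 < delta &
    forall (N : nat) (a b : 'I_N -> R),
      (forall i, [/\ c <= a i, a i <= b i & b i <= d]) ->
      trivIset setT (fun i => `]a i, b i[%classic) ->
      \sum_(i < N) (b i - a i) < delta ->
      \sum_(i < N) normc (f (b i) - f (a i)) < e.

Definition loc_abs_continuous_Rplus (f : R -> R[i]) : Prop :=
  forall c d : R, 0 < c -> c < d -> abs_continuous_on c d f.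

(* R[i] carries no normed-module structure over R in the library, so the
   derivative of a complex-valued function of a real variable is taken on real
   and imaginary parts. *)
Definition is_cderive (f : R -> R[i]) (x : R) (v : R[i]) : Prop :=
  is_derive x 1 (fun y : R => complex.Re (f y)) (complex.Re v) /\
  is_derive x 1 (fun y : R => complex.Im (f y)) (complex.Im v).

End FunctionSpaces.

Section SingularityOrders.
Variable n : nat.

Definition singularity_orders (I : 'I_n.-1 -> nat) : Prop :=
  forall nu : 'I_n.-1,
    (I nu <= (if odd nu then n./2 - nu./2 - 1 else n./2 - nu./2))%N.

Definition in_K (I : 'I_n.-1 -> nat) (nu : 'I_n.-1) : bool :=
  ~~ odd n &&
  (I nu == (if odd nu then n./2 - nu./2 - 1 else n./2 - nu./2))%N.

Definition coefficients (R : realType) (I : 'I_n.-1 -> nat)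
    (sigma : 'I_n.-1 -> R -> R[i]) : Prop :=
  (forall nu, in_Lp_Rplus 1 (sigma nu)) /\
  (forall nu, in_K I nu -> in_Lp_Rplus 2 (sigma nu)).

End SingularityOrders.

Section Matrices.

(* C_i^{s-1}, with C_i^{-1} = 0 *)
Definition bin_pred (i s : nat) : nat := if s is s'.+1 then 'C(i, s') else 0.

(* With k = nu./2, the entry (r, j) = (s + k, i - s + k), resp.
   (s + k, i + 1 - s + k), is recognized by s = r - k. *)
Definition chi (K : pzRingType) (m nu i : nat) : 'M[K]_m.+1 :=
  \matrix_(r < m.+1, j < m.+1)
    let k := nu./2 in
    let s := (r - k)%N in
    if odd nu then
      if [&& k <= r, s <= i.+1 & j == (i.+1 - s + k)%N :> nat]%N
      then ('C(i.+1, s))%:R - 2 * (bin_pred i s)%:R else 0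
    else
      if [&& k <= r, s <= i & j == (i - s + k)%N :> nat]%N
      then ('C(i, s))%:R else 0.

(* Rows and columns of F are numbered from 1 to n and those of Q from 0 to m;
   k and j below are the 1-based indices of F. *)
Definition assoc_matrix (K : pzRingType) (n : nat) (Q : 'M[K]_((n./2).+1)) :
    'M[K]_n :=
  let m := n./2 in
  let q (r j : nat) : K := Q (inord r) (inord j) in
  \matrix_(k0 < n, j0 < n)
    let k := k0.+1 in
    let j := j0.+1 in
    if j == k.+1 then 1
    else if odd n then
      if (m < k)%N && (j <= m.+1)%N
      then (-1) ^+ k * q j.-1 ((2 * m).+1 - k)%N
      else 0
    else
      if (k == m) && (j <= m)%N
      then (-1) ^+ m.+1 * q j.-1 m
      else if (m < k)%N && (j == m.+1)
      then (-1) ^+ k.+1 * q m (2 * m - k)%N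
      else if (m < k)%N && (j <= m)%N
      then (-1) ^+ k.+1 * q j.-1 (2 * m - k)%N
           + (-1) ^+ (m + k) * q j.-1 m * q m (2 * m - k)%N
      else 0.

Definition Qmatrix (R : realType) (n : nat) (I : 'I_n.-1 -> nat)
    (sigma : 'I_n.-1 -> R -> R[i]) (x : R) : 'M[R[i]]_((n./2).+1) :=
  \sum_(nu < n.-1) sigma nu x *: chi R[i] n./2 nu (I nu).

Definition Fmatrix (R : realType) (n : nat) (I : 'I_n.-1 -> nat)
    (sigma : 'I_n.-1 -> R -> R[i]) (x : R) : 'M[R[i]]_n :=
  assoc_matrix (Qmatrix I sigma x).

Definition unit_lower_triangular (K : pzRingType) (n : nat) (A : 'M[K]_n) :
    bool :=
  is_trig_mx A && [forall k, A k k == 1].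

End Matrices.

(* Main.v *)
Require Import Defs.
From mathcomp Require Import all_boot all_order all_algebra.
From mathcomp Require Import complex.
From mathcomp Require Import all_classical all_reals all_analysis.
From mathcomp Require Import measurable_realfun polyrcf zify ring lra.
Import Order.TTheory GRing.Theory Num.Theory.
Import numFieldNormedType.Exports.
Local Open Scope classical_set_scope.
Local Open Scope ring_scope.
Local Open Scope complex_scope.

Set Implicit Arguments.
Unset Strict Implicit.
Unset Printing Implicit Defensive.

(** Write [F = J + G], where [J] is the superdiagonal shift; [G] lives in the
    last rows and the first [m + 1] columns.  In the rows above [G] and in the
    columns to its right the equation [P' + P F~ = F P] only involves [J], and
    it propagates the first row and the last column of [P]: so [P = 1 + E] with
    [E] confined to the lower left [m x m] block ([top_rows], [right_cols]).

    Reindex that block, with 0-based indices, by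
    [b_(r,s) = (-1)^s E_(n-1-s, r)] and extend it by zero.  The remaining
    entries of the equation all read
      [b'_(r,s) + b_(r-1,s) + b_(r,s-1) = - (q - q~)_(r,s)],  [0 <= r, s <= m],
    ([reduced_system]; for even [n] the rank one term of [F] cancels against
    the products of [E] with the row and the column bordering the block).
    Equivalently, the bilinear form [sum (q - q~)_(r,s) y^(r) z^(s)] is the
    total derivative of [- sum b_(r,s) y^(r) z^(s)].  The matrices [chi] are
    those for which this form, with [s_nu = sigma_nu - sigma~_nu], equals
      [sum_k s_2k (y^(k) z^(k))^(i_2k)
         + s_(2k+1) (y^(k) z^(k+1) - y^(k+1) z^(k))^(i_(2k+1))].
    A form of that kind is a total derivative only if every [s_nu] is a
    polynomial of degree less than [i_nu], and an integrable polynomial on the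
    half-line is zero.

    To make this elementary, induct on [k].  Once [s_nu = 0] for [nu < 2k] and
    [b] vanishes on the rows and columns before [k], the equations on row and
    column [k] contain just [s_2k] and [s_(2k+1)], each at a single place, and
    symmetrization separates them: [y_j = b_(k+j,k) + b_(k,k+j)], and likewise
    the difference, satisfies [y_j' + y_(j-1) = a s] for one index [j = i] and
    [y_j' + y_(j-1) = 0] for the other ones.  Such a chain
    ([derivative_chain_eq0]) is solved from both ends.  It vanishes for large
    [j], hence down to [j = i], where it says that [y_(i-1) = a s]; and from
    [y_0' = 0] upwards all the [y_j] with [j < i] are polynomials.  So [s] is
    an integrable polynomial, [s = 0], and then the whole chain vanishes
    ([vanishes_step], [total_derivative_eq0]).

    All derivatives exist only almost everywhere; integrating them rests on the
    fact that an absolutely continuous function whose derivative vanishes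
    almost everywhere is constant ([abs_continuous_derive0]).  The argument is
    run separately on real and imaginary parts. *)

(** * Absolutely continuous functions with zero derivative *)

Section AbsoluteContinuity.
Variable R : realType.
Implicit Types (f g : R -> R) (c d : R).

Definition real_abs_continuous_on c d f : Prop :=
  forall e : R, 0 < e -> exists2 delta : R, 0 < delta &
    forall (N : nat) (a b : 'I_N -> R),
      (forall i, [/\ c <= a i, a i <= b i & b i <= d]) ->
      trivIset setT (fun i => `]a i, b i[%classic) ->
      \sum_(i < N) (b i - a i) < delta ->
      \sum_(i < N) `|f (b i) - f (a i)| < e.

(** Consider the supremum of the points of [S]: the local hypothesis first puts
    it into [S], then lets one step past it unless it is already [d]. *)
Lemma interval_induction (S : set R) c d : c <= d -> S c ->
  (forall s, c <= s <= d -> exists2 r : R, 0 < r &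
     forall x y, c <= x <= s -> s <= y <= d -> s - r < x -> y < s + r ->
       S x -> S y) ->
  S d.
Proof.
move=> cd Sc step; pose T := S `&` `[c, d]%classic.
have Tc : T c by split => //=; rewrite in_itv /= lexx.
have ubT : ubound T d by move=> x [_] /=; rewrite in_itv /= => /andP[].
have supT : has_sup T by split; [exists c | exists d].
have cs : c <= sup T by apply: ub_le_sup => //; exists d.
have sd : sup T <= d by apply: ge_sup => //; exists c.
have csd : c <= sup T <= d by rewrite cs sd.
have [r r0 stepr] := step _ csd.
have [x [Sx]] := sup_adherent r0 supT.
rewrite /= in_itv /= => /andP[cx xd] xr.
have xs : x <= sup T.
  by apply: ub_le_sup; [exists d | split => //=; rewrite in_itv /= cx xd].
have Sy y : sup T <= y <= d -> y < sup T + r -> S y.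
  by move=> ysd yr; apply: (stepr x) => //; rewrite cx xs.
have [sltd|dles] := ltP (sup T) d; last first.
  by apply: Sy; [rewrite sd lexx | apply: le_lt_trans dles _; rewrite ltrDl].
pose y := Num.min d (sup T + r / 2).
have ysd : sup T < y <= d.
  by rewrite /y lt_min sltd /= ltrDl divr_gt0 // ge_min lexx.
have /andP[sy yd] := ysd.
have : y <= sup T.
  apply: ub_le_sup; first by exists d.
  split; last by rewrite /= in_itv /= yd (le_trans cs) ?(ltW sy).
  apply: Sy; first by rewrite (ltW sy) yd.
  by rewrite gt_min ltrD2l gtr_pMr // orbC invf_lt1 // ltr1n.
by rewrite leNgt sy.
Qed.

Lemma sum_disjoint_itv_le (N : nat) (a b : 'I_N -> R) (U : set R) :
  (forall i, a i <= b i) -> trivIset setT (fun i => `]a i, b i[%classic) ->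
  (forall i, `]a i, b i[%classic `<=` U) -> measurable U ->
  ((\sum_(i < N) (b i - a i))%:E <= lebesgue_measure U)%E.
Proof.
move=> ab tr sub mU.
have enumT : [set` index_enum 'I_N] = setT :> set 'I_N.
  by apply/seteqP; split => // i _ /=; rewrite mem_index_enum.
apply: (@le_trans _ _ (lebesgue_measure
    (\bigcup_(i in [set` index_enum 'I_N]) `]a i, b i[%classic))).
  rewrite measure_fin_bigcup //; last by rewrite enumT.
  rewrite -fsbig_seq ?index_enum_uniq // -sumEFin lee_sum // => i _.
  rewrite [leRHS](_ : _ = lebesgue_measure (`]a i, b i[%classic : set R)) //.
  rewrite lebesgue_measure_itv /= lte_fin; case: ltP => [_|ba].
    by rewrite EFinB.
  by rewrite lee_fin subr_le0.
apply: le_measure.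
- by rewrite inE; exact: fin_bigcup_measurable.
- by rewrite inE.
- by apply: bigcup_sub => i _; exact: sub.
Qed.

(** The bound also holds at [y = x], where the difference quotient says nothing;
    this is what allows gluing estimates on both sides of [x]. *)
Lemma is_derive0_near f (x e : R) : is_derive x 1 f 0 -> 0 < e ->
  exists2 r : R, 0 < r &
    forall y, `|y - x| < r -> `|f y - f x| <= e * `|y - x|.
Proof.
move=> [df f0] e0.
have : (h^-1 *: ((f \o shift x) (h *: 1) - f x) @[h --> 0^'] --> 'D_1 f x).
  exact: df.
rewrite f0; move/cvgrPdist_le => /(_ _ e0) /nbhs_ballP[r /= r0 fr].
exists r => // y yr.
have [->|yx] := eqVneq y x; first by rewrite !subrr normr0 mulr0.
have := fr (y - x); rewrite /ball /= sub0r normrN => /(_ yr).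
rewrite subr_eq0 => /(_ yx).
rewrite /= [(y - x) *: 1](mulr1 (y - x)) subrK sub0r normrN normrZ normfV.
by rewrite mulrC ler_pdivrMr // normr_gt0 subr_eq0.
Qed.

(** Enclose the null set of bad points, together with the two end points, in an
    open set [U] so small that [f] varies by less than [e / 2] over disjoint
    intervals inside [U].  Around a good point [f] has slope at most [e2];
    around a bad one small intervals lie in [U].  Interval induction strings
    these local estimates together from [c] to [d]. *)
Lemma abs_continuous_derive0 c d f : c <= d -> real_abs_continuous_on c d f ->
  {ae lebesgue_measure, forall x : R, c < x < d -> is_derive x 1 f 0} ->
  f d = f c.
Proof.
move=> cd acf [E [mE E0 subE]].
apply/eqP; rewrite -subr_eq0 -normr_le0.
apply/ler_addgt0Pr => e e0.
have e1gt0 : 0 < e / 2 by rewrite divr_gt0.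
have dc1 : 0 < d - c + 1 by rewrite ltr_wpDl ?subr_ge0.
pose e2 := e / 2 / (d - c + 1).
have e2gt0 : 0 < e2 by rewrite divr_gt0.
have [delta delta0 fdelta] := acf _ e1gt0.
have mE' : measurable (E `|` [set c; d] : set R).
  by apply: measurableU => //; exact: measurableU.
have E'0 : lebesgue_measure (E `|` [set c; d] : set R) = 0%E.
  apply: (proj1 (negligibleP lebesgue_measure mE')); apply: negligibleU; first exact/negligibleP.
  by apply: negligibleU; apply/negligibleP => //; exact: lebesgue_measure_set1.
have [|U [oU EU Udelta]] := lebesgue_regularity_outer mE' _ delta0.
  by rewrite [X in (X < _)%E](_ : _ = 0%E) // ltry.
have mU : measurable U by exact: open_measurable.
have {}Udelta : (lebesgue_measure U < delta%:E)%E.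
  rewrite -(setDUK EU); apply: le_lt_trans (measureU2 _ _ _) _ => //.
    exact: measurableD.
  by rewrite [X in (X + _)%E](_ : _ = 0%E) // add0e.
(* from c to x, the variation is at most e2 times the length travelled plus the
   increments over finitely many disjoint intervals spent inside U *)
pose S (x : R) := exists (N : nat) (a b : 'I_N -> R),
  [/\ forall i, [/\ c <= a i, a i <= b i & b i <= x],
      trivIset setT (fun i => `]a i, b i[%classic),
      forall i, `]a i, b i[%classic `<=` U &
      `|f x - f c| <= e2 * (x - c) + \sum_(i < N) `|f (b i) - f (a i)|].
have : S d.
  apply: (@interval_induction _ c) => //.
    exists 0%N, (fun=> 0), (fun=> 0); split; [by case|by case|by case|].
    by rewrite !subrr normr0 mulr0 big_ord0 addr0.
  move=> s /andP[cs sd].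
  have [Us|nUs] := pselect (U s).
    have /nbhs_ballP[r /= r0 ballU] : nbhs s U by apply: open_nbhs_nbhs.
    exists r => // x y /andP[cx xs] /andP[sy yd] sx ys [N [a [b [abx tr sub fx]]]].
    (* spend the interval from x to y inside U: append it to the family *)
    exists N.+1, (fun i => if unlift ord_max i is Some j then a j else x),
      (fun i => if unlift ord_max i is Some j then b j else y).
    have xy := le_trans xs sy.
    split.
    - move=> i; case: unliftP => [j _|_] //.
      by have [? ? ?] := abx j; split => //; exact: le_trans xy.
    - apply/trivIsetP => i j _ _; case: unliftP => [i' ->|->];
        case: unliftP => [j' ->|->]; last by rewrite eqxx.
      + move=> ij; move/trivIsetP: tr; apply => //.
        by apply: contraNN ij => /eqP ->.
      + have [_ _ bx] := abx i' => _.
        by apply/seteqP; split => // z [] /=; rewrite !in_itv /= => ? ?; lra.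
      + have [_ _ bx] := abx j' => _.
        by apply/seteqP; split => // z [] /=; rewrite !in_itv /= => ? ?; lra.
    - move=> i; case: unliftP => [j _|_]; first exact: sub.
      move=> z; rewrite /= in_itv /= => /andP[xz zy]; apply: ballU.
      rewrite /ball /= ltr_norml; lra.
    - rewrite big_ord_recr /= unlift_none.
      under eq_bigr => i _.
        rewrite (_ : widen_ord _ _ = lift ord_max i) ?liftK; last first.
          by apply: val_inj; rewrite /= /bump leqNgt ltn_ord.
        over.
      have := ler_normD (f y - f x) (f x - f c).
      rewrite addrA subrK.
      have : e2 * (x - c) <= e2 * (y - c) by rewrite ler_pM2l // lerD2r.
      lra.
  have [r r0 fr] : exists2 r : R, 0 < r &
      forall y, `|y - s| < r -> `|f y - f s| <= e2 * `|y - s|.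
    have sE : c < s < d.
      rewrite !lt_neqAle cs sd !andbT.
      by apply/andP; split; apply: contra_notN nUs => /eqP ?; apply: EU; right; [left|right].
    have [|fs] := pselect (is_derive s 1 f 0).
      by move=> fs; exact: (is_derive0_near fs e2gt0).
    by exfalso; apply/nUs/EU; left; apply: subE => /(_ sE).
  exists r => // x y /andP[cx xs] /andP[sy yd] sx ys [N [a [b [abx tr sub fx]]]].
  exists N, a, b; split => //.
    by move=> i; have [? ? ?] := abx i; split => //; lra.
  have hx : `|f x - f s| <= e2 * (s - x).
    rewrite -[s - x]ger0_norm ?subr_ge0 // [X in _ * X]distrC.
    by apply: fr; rewrite ltr_norml; lra.
  have hy : `|f y - f s| <= e2 * (y - s).
    rewrite -[y - s]ger0_norm ?subr_ge0 //.
    by apply: fr; rewrite ltr_norml; lra.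
  have : `|f y - f c| <= `|f y - f s| + `|f x - f s| + `|f x - f c|.
    have := ler_normD (f y - f s - (f x - f s)) (f x - f c).
    have := ler_normB (f y - f s) (f x - f s).
    rewrite (_ : f y - f s - (f x - f s) + (f x - f c) = f y - f c); last by ring.
    lra.
  lra.
case=> [N [a [b [abx tr sub fx]]]].
have lenab : \sum_(i < N) (b i - a i) < delta.
  rewrite -lte_fin; apply: le_lt_trans Udelta.
  by apply: sum_disjoint_itv_le => // i; have [] := abx i.
have := fdelta _ _ _ abx tr lenab => sume.
rewrite add0r; apply: le_trans fx _.
rewrite [leRHS](splitr e); apply: lerD; last exact: ltW.
by rewrite /e2 -mulrA ler_piMr ?(ltW e1gt0) // mulrC ler_pdivrMr // mul1r lerDl.
Qed.

End AbsoluteContinuity.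

(** * Local absolute continuity on the half-line *)

Section HalfLine.
Variable R : realType.
Implicit Types (f g : R -> R) (p q : {poly R}).

Lemma ae_imply (P Q : R -> Prop) : (forall x, P x -> Q x) ->
  {ae lebesgue_measure, forall x, P x} -> {ae lebesgue_measure, forall x, Q x}.
Proof.
by move=> PQ; apply: negligibleS => x /= nQ /PQ /nQ.
Qed.

Lemma ae_both (P Q : R -> Prop) : {ae lebesgue_measure, forall x, P x} ->
  {ae lebesgue_measure, forall x, Q x} ->
  {ae lebesgue_measure, forall x, P x /\ Q x}.
Proof.
move=> aeP aeQ; apply: negligibleS (negligibleU aeP aeQ) => x /=.
by move/not_andP.
Qed.

Definition real_loc_abs_continuous f : Prop :=
  forall c d : R, 0 < c -> c < d -> real_abs_continuous_on c d f.

Lemma real_abs_continuous_lipschitz c d f (k : R) : 0 < k ->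
  (forall x y, c <= x <= d -> c <= y <= d -> `|f y - f x| <= k * `|y - x|) ->
  real_abs_continuous_on c d f.
Proof.
move=> k0 fk e e0; exists (e / k); first exact: divr_gt0.
move=> N a b abcd _; rewrite ltr_pdivlMr // mulrC mulr_sumr; apply: le_lt_trans.
apply: ler_sum => i _; have [ca ab bd] := abcd i.
by apply: le_trans (fk _ _ _ _) _; rewrite ?ger0_norm ?subr_ge0 //; lra.
Qed.

Lemma real_abs_continuousD c d f g : real_abs_continuous_on c d f ->
  real_abs_continuous_on c d g -> real_abs_continuous_on c d (f \+ g).
Proof.
move=> acf acg e e0; have e2 : 0 < e / 2 by rewrite divr_gt0.
have [d1 d10 f1] := acf _ e2; have [d2 d20 g2] := acg _ e2.
exists (Num.min d1 d2) => [|N a b abcd tr]; first by rewrite lt_min d10.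
rewrite lt_min => /andP[/(f1 _ _ _ abcd tr) h1 /(g2 _ _ _ abcd tr) h2].
rewrite [ltRHS](splitr e); apply: le_lt_trans (ltrD h1 h2).
rewrite -big_split ler_sum //= => i _.
by rewrite opprD addrACA; exact: ler_normD.
Qed.

Lemma real_abs_continuousN c d f : real_abs_continuous_on c d f ->
  real_abs_continuous_on c d (\- f).
Proof.
move=> acf e e0; have [d1 d10 f1] := acf _ e0; exists d1 => // N a b abcd tr.
move=> /(f1 _ _ _ abcd tr); apply: le_lt_trans.
by apply: ler_sum => i _; rewrite -opprD normrN.
Qed.

Lemma real_abs_continuous_poly c d p : real_abs_continuous_on c d (horner p).
Proof.
have [k k1 pk] := poly_lipshitz p c d.
apply: (@real_abs_continuous_lipschitz _ _ _ k); first by rewrite (lt_le_trans ltr01).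
by move=> x y cx cy; apply: pk; rewrite in_itv.
Qed.

Lemma real_loc_abs_continuousD f g : real_loc_abs_continuous f ->
  real_loc_abs_continuous g -> real_loc_abs_continuous (f \+ g).
Proof. by move=> lf lg c d c0 cd; apply: real_abs_continuousD; auto. Qed.

Lemma real_loc_abs_continuousB f g : real_loc_abs_continuous f ->
  real_loc_abs_continuous g -> real_loc_abs_continuous (f \- g).
Proof.
move=> lf lg c d c0 cd; apply: real_abs_continuousD; first exact: lf.
by apply: real_abs_continuousN; exact: lg.
Qed.

(** A point where [f x <> v] would have, to its right, an interval of positive
    length on which [f] stays away from [v]. *)
Lemma real_loc_abs_continuous_ae_const f (v : R) : real_loc_abs_continuous f ->
  {ae lebesgue_measure, forall x : R, 0 < x -> f x = v} ->
  forall x : R, 0 < x -> f x = v.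
Proof.
move=> lf [E [mE E0 subE]] x x0.
apply/eqP; rewrite -subr_eq0 -normr_le0; apply/ler_addgt0Pr => e e0.
have [||delta delta0 fd] := lf (x / 2) (x + 1) _ _ e e0; first by rewrite divr_gt0.
  lra.
pose y0 := Num.min (x + delta) (x + 1).
have [y yx fy] : exists2 y, x < y < y0 & f y = v.
  apply: contrapT => noy.
  have : (lebesgue_measure (`]x, y0[%classic : set R) <= lebesgue_measure E)%E.
    have mI : measurable (`]x, y0[%classic : set R) by exact: measurable_itv.
    apply: le_measure; [exact: (mem_set mI)|exact: (mem_set mE)|].
    move=> y; rewrite /= in_itv /= => yxy; apply: subE => fy.
    apply: noy; exists y => //; apply: fy.
    by have /andP[xy _] := yxy; exact: lt_trans xy.
  rewrite [X in (_ <= X)%E](_ : _ = 0%E) // lebesgue_measure_itv /= lte_fin.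
  have xy0 : x < y0 by rewrite lt_min; lra.
  by rewrite xy0 -EFinB lee_fin subr_le0 leNgt xy0.
have /andP[xy] := yx; rewrite lt_min => /andP[yd y1].
have := fd 1%N (fun=> x) (fun=> y).
rewrite !big_ord1 fy distrC add0r => fxy; apply/ltW/fxy.
- by move=> _; split; lra.
- by apply/trivIsetP => i j _ _; rewrite !ord1.
- lra.
Qed.

Lemma real_loc_abs_continuous_derive0 f : real_loc_abs_continuous f ->
  {ae lebesgue_measure, forall x : R, 0 < x -> is_derive x 1 f 0} ->
  forall x, 0 < x -> f x = f 1.
Proof.
move=> lf f0 x x0.
have key c d : 0 < c -> c < d -> f d = f c.
  move=> c0 cd; apply: abs_continuous_derive0; [exact: ltW|exact: lf|].
  by apply: ae_imply f0 => y fy /andP[cy _]; apply: fy; exact: lt_trans cy.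
by have [x1|x1|->//] := ltgtP x 1; [rewrite (key x 1)|rewrite (key 1 x)].
Qed.

(** Subtract the polynomial primitive of [q]; what is left is absolutely
    continuous and has zero derivative almost everywhere. *)
Lemma polynomial_primitive f q : real_loc_abs_continuous f ->
  {ae lebesgue_measure, forall x : R, 0 < x -> is_derive x 1 f q.[x]} ->
  exists p, forall x, 0 < x -> f x = p.[x].
Proof.
move=> lf fq.
pose Q := \poly_(i < (size q).+1) (q`_i.-1 / i%:R).
have dQ : Q^`() = q.
  apply/polyP => i; rewrite coef_deriv coef_poly ltnS.
  have [iq|iq] := ltnP i (size q); last by rewrite mul0rn nth_default.
  by rewrite -[LHS]mulr_natr divfK // pnatr_eq0.
have acg : real_loc_abs_continuous (f \- horner Q).
  apply: real_loc_abs_continuousB => // c d _ _; exact: real_abs_continuous_poly.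
have g0 : {ae lebesgue_measure, forall x : R, 0 < x -> is_derive x 1 (f \- horner Q) 0}.
  apply: ae_imply fq => x fx x0; rewrite -(subrr q.[x]) -{2}dQ.
  by apply: is_deriveB; exact: fx.
have := real_loc_abs_continuous_derive0 acg g0; set v := (_ \- _) 1 => fv.
exists (Q + v%:P) => x x0.
by rewrite hornerD hornerC -(fv _ x0) addrC subrK.
Qed.

End HalfLine.

(** * Integrable polynomials and chains of derivatives *)

Section Chains.
Variable R : realType.
Implicit Types (s : R -> R) (p : {poly R}).

Definition integrable_Rplus s : Prop :=
  lebesgue_measure.-integrable (`]0, +oo[%classic : set R) (EFin \o s).

(** For large [x] the absolute value of a nonzero polynomial is at least that of
    its leading coefficient, a positive constant, whose integral is infinite. *)
Lemma integrable_polynomial_eq0 p s : integrable_Rplus s ->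
  {ae lebesgue_measure, forall x : R, 0 < x -> s x = p.[x]} -> p = 0.
Proof.
move=> /integrableP[ms sfin] sp; apply: contrapT => /eqP p0.
have lp : 0 < `|lead_coef p| by rewrite normr_gt0 lead_coef_eq0.
have [X pX] : exists X, forall x, X <= x -> `|lead_coef p| <= `|p.[x]|.
  have [l0|l0|/eqP] := ltgtP (lead_coef p) 0; last by rewrite lead_coef_eq0 (negPf p0).
  - have [|X pX] := @poly_pinfty_gt_lc _ (- p); first by rewrite lead_coefN oppr_gt0.
    exists X => x /pX; rewrite lead_coefN hornerN ltr0_norm // -(normrN p.[x]) => h.
    exact: le_trans (ler_norm _).
  - have [X pX] := poly_pinfty_gt_lc l0.
    exists X => x /pX; rewrite gtr0_norm // => h; exact: le_trans (ler_norm _).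
pose Y := Num.max X 1.
have mY : measurable (`[Y, +oo[%classic : set R) by exact: measurable_itv.
have Ysub : `[Y, +oo[%classic `<=` (`]0, +oo[%classic : set R).
  move=> x; rewrite /= !in_itv /= !andbT ge_max => /andP[_ x1].
  exact: lt_le_trans x1.
have ms' := measurable_funS (measurable_itv `]0, +oo[) Ysub ms.
have : (\int[lebesgue_measure]_(x in (`[Y, +oo[%classic : set R)) (cst `|lead_coef p|%:E x)
    <= \int[lebesgue_measure]_(x in (`]0%R, +oo[%classic : set R)) `|(EFin \o s) x|)%E.
  apply: (@le_trans _ _ (\int[lebesgue_measure]_(x in (`[Y, +oo[%classic : set R))
     `|(EFin \o s) x|)%E).
    apply: ae_ge0_le_integral => //.
    - by move=> x _; rewrite lee_fin.
    - exact: measurableT_comp.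
    - apply: ae_imply sp => x sx; rewrite /= in_itv /= andbT ge_max => /andP[xX x1].
      by rewrite lee_fin sx ?pX // (lt_le_trans ltr01).
  apply: ge0_subset_integral => //.
  exact: measurableT_comp.
rewrite integral_cst //= lebesgue_measure_itv /= ltry /=.
have -> : (+oo - Y%:E = +oo :> \bar R)%E by [].
by rewrite gt0_muley ?lte_fin // leNgt sfin.
Qed.

(** The system [y_j' + y_(j-1) = a s] at [j = i], [= 0] elsewhere.  Descending
    from the vanishing links kills every [y_j] with [j >= i]; the equation at
    [i] then identifies [a s] with [y_(i-1)]; ascending from [y_0' = 0] makes
    [y_(i-1)] a polynomial, so integrability forces [s = 0].  With [s = 0] the
    descent no longer stops at [i]. *)
Lemma derivative_chain_eq0 (y : nat -> R -> R) s (a : R) (i L : nat) : a != 0 ->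
  (forall j, real_loc_abs_continuous (y j)) ->
  (forall j x, (L <= j)%N -> 0 < x -> y j x = 0) ->
  integrable_Rplus s ->
  (forall j, {ae lebesgue_measure, forall x : R, 0 < x ->
     is_derive x 1 (y j)
       ((if j == i then a * s x else 0) - (if j is j'.+1 then y j' x else 0))}) ->
  (forall j x, 0 < x -> y j x = 0) /\
  {ae lebesgue_measure, forall x : R, 0 < x -> s x = 0}.
Proof.
move=> a0 ly yL ints dy.
(* a link that vanishes identically has derivative zero, so its equation
   becomes a relation between s and the previous link *)
have link j : (forall x, 0 < x -> y j x = 0) ->
    {ae lebesgue_measure, forall x : R, 0 < x ->
      (if j == i then a * s x else 0) - (if j is j'.+1 then y j' x else 0) = 0}.
  move=> yj0; apply: ae_imply (dy j) => x /[swap] x0 /(_ x0) [_ <-].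
  have [_ <-] := is_derive_cst (0 : R) x (1 : R).
  apply: near_eq_derive; near=> z; apply: yj0; near: z.
  exact: lt_nbhsr.
have down i0 : (i <= i0)%N \/ {ae lebesgue_measure, forall x : R, 0 < x -> s x = 0} ->
    forall j x, (i0 <= j)%N -> 0 < x -> y j x = 0.
  move=> hi; have H d : forall j x, (i0 <= j)%N -> (L <= j + d)%N -> 0 < x -> y j x = 0.
    elim: d => [|d IH] j x ij Ljd; first by rewrite addn0 in Ljd; exact: yL.
    move: x; apply: real_loc_abs_continuous_ae_const => //.
    have yj1 x : 0 < x -> y j.+1 x = 0 by apply: IH; rewrite ?addSnnS // leqW.
    case: hi => [ii0|s0].
      apply: ae_imply (link _ yj1) => x h x0; move: (h x0) => /eqP.
      by rewrite gtn_eqF ?ltnS ?(leq_trans ii0) // sub0r oppr_eq0 => /eqP.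
    apply: ae_imply (ae_both s0 (link _ yj1)) => x [sx yx] x0.
    move: (yx x0); rewrite sx // mulr0 if_same sub0r => /eqP.
    by rewrite oppr_eq0 => /eqP.
  by move=> j x ij; apply: (H L) => //; exact: leq_addl.
have yi := down i (or_introl (leqnn i)).
have up j : (j < i)%N -> exists p, forall x, 0 < x -> y j x = p.[x].
  elim: j => [|j IH] ji.
    apply: (@polynomial_primitive _ _ 0) => //.
    apply: ae_imply (dy 0%N) => x /[apply].
    by rewrite ltn_eqF // subrr horner0.
  have [p yp] := IH (ltnW ji).
  apply: (@polynomial_primitive _ _ (- p)) => //.
  apply: ae_imply (dy j.+1) => x dyx x0; move: (dyx x0).
  by rewrite ltn_eqF // sub0r hornerN yp.
have s0 : {ae lebesgue_measure, forall x : R, 0 < x -> s x = 0}.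
  have := link i (fun x => yi i x (leqnn i)).
  case: i {down link dy} yi up => [|i] yi up.
    apply: ae_imply => x h x0; move: (h x0).
    by rewrite subr0 => /eqP; rewrite mulf_eq0 (negPf a0) => /eqP.
  have [p yp] := up i (leqnn _).
  rewrite eqxx => h.
  have sp : {ae lebesgue_measure, forall x : R, 0 < x -> s x = (a^-1 *: p).[x]}.
    apply: ae_imply h => x hx x0; move: (hx x0) => /eqP.
    by rewrite subr_eq0 yp // hornerZ => /eqP <-; rewrite mulKf.
  have p0 := integrable_polynomial_eq0 ints sp.
  by apply: ae_imply sp => x hx x0; rewrite hx // p0 horner0.
by split=> // j x; apply: (down 0%N (or_intror s0)).
Unshelve. all: by end_near. Qed.

End Chains.

(** * The bilinear form of the coefficients *)

Section Chi.
Variable K : pzRingType.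

(** The entries of [chi] with plain natural numbers as indices, which makes the
    dependence on the size of the matrix disappear. *)
Definition chi_entry (nu i r s : nat) : K :=
  let k := nu./2 in
  let t := (r - k)%N in
  if odd nu then
    if [&& k <= r, t <= i.+1 & s == i.+1 - t + k]%N
    then ('C(i.+1, t))%:R - 2 * (bin_pred i t)%:R else 0
  else
    if [&& k <= r, t <= i & s == i - t + k]%N
    then ('C(i, t))%:R else 0.

Lemma chiE (m nu i : nat) (r s : 'I_m.+1) : chi K m nu i r s = chi_entry nu i r s.
Proof. by rewrite mxE. Qed.

(** The matrix represents the [i]-th derivative of an expression with [nu]
    derivatives in all, at least [nu./2] of them on each factor. *)
Lemma chi_entry_support (nu i r s : nat) :
  ~~ [&& nu./2 <= r, nu./2 <= s & r + s == i + nu]%N -> chi_entry nu i r s = 0.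
Proof.
rewrite /chi_entry => h; have := odd_double_half nu.
case: ifP => o; case: ifP => // /and3P[h1 h2 /eqP h3] eqnu; case/negP: h; lia.
Qed.

(** On the border row and column of index [nu./2] there is a single nonzero
    entry: it is [1] in both places when [nu] is even, while for odd [nu] the
    two entries have opposite signs.  This is what lets sums and differences of
    transposed entries separate [sigma_2k] from [sigma_(2k+1)]. *)
Lemma chi_entry_even_col (k i j : nat) : chi_entry k.*2 i (k + j) k = (j == i)%:R.
Proof.
rewrite /chi_entry odd_double doubleK leq_addr addKn /=.
have [->|ji] := eqVneq j i; first by rewrite leqnn subnn eqxx binn.
by case: ifP => // ?; exfalso; lia.
Qed.

Lemma chi_entry_even_row (k i j : nat) : chi_entry k.*2 i k (k + j) = (j == i)%:R.
Proof.
rewrite /chi_entry odd_double doubleK leqnn subnn subn0 addnC eqn_add2r /=.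
by case: eqP => // _; rewrite bin0.
Qed.

Lemma chi_entry_odd_col (k i j : nat) :
  chi_entry k.*2.+1 i (k + j) k = - (j == i.+1)%:R.
Proof.
rewrite /chi_entry /= odd_double /= uphalf_double leq_addr addKn /=.
have [->|ji] := eqVneq j i.+1; last by rewrite oppr0; case: ifP => // ?; exfalso; lia.
by rewrite leqnn subnn eqxx /= !binn mulr1 (natrD _ 1 1) opprD addrA subrr sub0r.
Qed.

Lemma chi_entry_odd_row (k i j : nat) :
  chi_entry k.*2.+1 i k (k + j) = (j == i.+1)%:R.
Proof.
rewrite /chi_entry /= odd_double /= uphalf_double leqnn subnn subn0 /=.
rewrite addnC eqn_add2r; case: eqP => // _.
by rewrite bin0 mulr0 subr0.
Qed.

End Chi.

(** * Total derivatives vanish *)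

Section TotalDerivative.
Variable R : realType.

Lemma is_derive_half_line_cst (f : R -> R) (v x : R) :
  (forall x, 0 < x -> f x = v) -> 0 < x -> is_derive x 1 f 0.
Proof.
move=> fv x0; apply: (@near_eq_is_derive _ _ _ (cst v)).
near=> z; apply/esym/fv; near: z; exact: lt_nbhsr.
Unshelve. all: by end_near. Qed.

Variables (m : nat) (I : nat -> nat) (sigma : nat -> R -> R).
Variable b : nat -> nat -> R -> R.

Definition form_coef (r s : nat) (x : R) : R :=
  \sum_(0 <= nu < m.*2) sigma nu x * chi_entry R nu (I nu) r s.

Definition pred_row (r s : nat) (x : R) : R := if r is r'.+1 then b r' s x else 0.
Definition pred_col (r s : nat) (x : R) : R := if s is s'.+1 then b r s' x else 0.

(* both bounds on the singularity orders, for even and for odd indices *)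
Hypothesis order_le : forall nu, (nu < m.*2)%N -> (I nu + uphalf nu <= m)%N.
Hypothesis sigma_integrable : forall nu, integrable_Rplus (sigma nu).
Hypothesis b_ac : forall r s, real_loc_abs_continuous (b r s).
Hypothesis b_support : forall r s x, 0 < x -> (m <= r)%N || (m <= s)%N -> b r s x = 0.
Hypothesis b_system : forall r s, (r <= m)%N -> (s <= m)%N ->
  {ae lebesgue_measure, forall x : R, 0 < x ->
    is_derive x 1 (b r s) (- form_coef r s x - pred_row r s x - pred_col r s x)}.

Lemma form_coef_out r s x : (m < r)%N || (m < s)%N -> form_coef r s x = 0.
Proof.
move=> rs; rewrite /form_coef big_nat big1 // => nu /= numm.
rewrite chi_entry_support ?mulr0 //; apply/negP => /and3P[h1 h2 /eqP h3].
have := order_le numm; have := odd_double_half nu; rewrite uphalf_half; lia.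
Qed.

(** Outside of the square [r, s <= m] all the terms vanish; having the equations
    for all indices avoids treating the far end of each chain apart. *)
Lemma total_system r s : {ae lebesgue_measure, forall x : R, 0 < x ->
    is_derive x 1 (b r s) (- form_coef r s x - pred_row r s x - pred_col r s x)}.
Proof.
have [/andP[rm sm]|] := boolP ((r <= m) && (s <= m))%N; first exact: b_system.
rewrite negb_and -!ltnNge => out; apply: aeW => x x0.
have row0 : pred_row r s x = 0.
  rewrite /pred_row; case: r out => // r out; apply: b_support => //.
  by case/orP: out => [|/ltnW ->]; rewrite ?ltnS ?orbT // => ->.
have col0 : pred_col r s x = 0.
  rewrite /pred_col; case: s out {row0} => // s out; apply: b_support => //.
  by case/orP: out => [/ltnW ->|]; rewrite ?ltnS ?orbT // => ->; rewrite orbT.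
rewrite form_coef_out // row0 col0 !subr0 oppr0.
apply: is_derive_half_line_cst x0 => z z0; apply: b_support => //.
by case/orP: out => /ltnW ->; rewrite ?orbT.
Qed.

Definition vanishes_upto (k : nat) : Prop :=
  (forall r s x, 0 < x -> (r < k)%N || (s < k)%N -> b r s x = 0) /\
  (forall nu, (nu < k.*2)%N ->
     {ae lebesgue_measure, forall x : R, 0 < x -> sigma nu x = 0}).

(** On row or column [k], the terms with [nu < 2k] vanish by induction and those
    with [nu >= 2k + 2] because both indices of their nonzero entries exceed
    [k]. *)
Lemma form_coef_step k r s x : (k < m)%N -> (r <= k)%N || (s <= k)%N ->
  (forall nu, (nu < k.*2)%N -> sigma nu x = 0) ->
  form_coef r s x = sigma k.*2 x * chi_entry R k.*2 (I k.*2) r s +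
                    sigma k.*2.+1 x * chi_entry R k.*2.+1 (I k.*2.+1) r s.
Proof.
move=> km rs s0; rewrite /form_coef (@big_cat_nat _ _ _ k.*2) //=; last by rewrite leq_double ltnW.
rewrite big_nat big1 ?add0r => [|nu /= nuk]; last by rewrite s0 ?mul0r.
rewrite big_ltn ?ltn_double // big_ltn -?doubleS ?leq_double //.
rewrite big_nat big1 ?addr0 // => nu /andP[kn nm].
rewrite chi_entry_support ?mulr0 //; apply/negP => /and3P[h1 h2 _].
have := half_leq kn; rewrite doubleK; lia.
Qed.

(** Sums of transposed entries form a chain driven by [sigma_2k], differences a
    chain driven by [sigma_(2k+1)]. *)
Lemma vanishes_step k : (k < m)%N -> vanishes_upto k -> vanishes_upto k.+1.
Proof.
move=> km [bk sk].
have aesk : {ae lebesgue_measure, forall x : R,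
    forall nu, (nu < k.*2)%N -> 0 < x -> sigma nu x = 0}.
  apply: ae_foralln => nu; have [nuk|knu] := ltnP nu k.*2; last exact: aeW.
  by apply: ae_imply (sk _ nuk).
have colk j : {ae lebesgue_measure, forall x : R, 0 < x -> is_derive x 1 (b (k + j) k)
    (- (sigma k.*2 x * (j == I k.*2)%:R - sigma k.*2.+1 x * (j == (I k.*2.+1).+1)%:R)
     - (if j is j'.+1 then b (k + j') k x else 0))}.
  apply: ae_imply (ae_both aesk (total_system (k + j) k)) => x [s0 db] x0.
  move: (db x0); rewrite (@form_coef_step k) ?leqnn ?orbT //; last by move=> nu /s0; apply.
  rewrite chi_entry_even_col chi_entry_odd_col mulrN.
  rewrite [pred_col _ _ _](_ : _ = 0) ?subr0; last first.
    by rewrite /pred_col; case: (k) bk => // k' bk'; apply: bk'; rewrite ?ltnSn ?orbT.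
  rewrite [pred_row _ _ _](_ : _ = if j is j'.+1 then b (k + j') k x else 0) //.
  case: j {db} => [|j]; last by rewrite addnS.
  by rewrite addn0 /pred_row; case: (k) bk => // k' bk'; apply: bk'; rewrite ?ltnSn.
have rowk j : {ae lebesgue_measure, forall x : R, 0 < x -> is_derive x 1 (b k (k + j))
    (- (sigma k.*2 x * (j == I k.*2)%:R + sigma k.*2.+1 x * (j == (I k.*2.+1).+1)%:R)
     - (if j is j'.+1 then b k (k + j') x else 0))}.
  apply: ae_imply (ae_both aesk (total_system k (k + j))) => x [s0 db] x0.
  move: (db x0); rewrite (@form_coef_step k) ?leqnn //; last by move=> nu /s0; apply.
  rewrite chi_entry_even_row chi_entry_odd_row.
  rewrite [pred_row _ _ _](_ : _ = 0) ?subr0; last first.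
    by rewrite /pred_row; case: (k) bk => // k' bk'; apply: bk'; rewrite ?ltnSn ?orbT.
  rewrite [pred_col _ _ _](_ : _ = if j is j'.+1 then b k (k + j') x else 0) //.
  case: j {db} => [|j]; last by rewrite addnS.
  by rewrite addn0 /pred_col; case: (k) bk => // k' bk'; apply: bk'; rewrite ?ltnSn ?orbT.
have farz j x : (m <= j)%N -> 0 < x -> b (k + j) k x = 0 /\ b k (k + j) x = 0.
  have mkj : (m <= j -> m <= k + j)%N by move=> ?; lia.
  by move=> /mkj mj x0; split; apply: b_support; rewrite ?mj ?orbT.
have [|||||y0 sev] := @derivative_chain_eq0 R (fun j => b (k + j) k \+ b k (k + j))
    (sigma k.*2) (- 2) (I k.*2) m.
- by rewrite oppr_eq0 pnatr_eq0.
- by move=> j; apply: real_loc_abs_continuousD.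
- by move=> j x mj x0; have [h1 h2] := farz j x mj x0; rewrite /= h1 h2 addr0.
- exact: sigma_integrable.
- move=> j; apply: ae_imply (ae_both (colk j) (rowk j)) => x [dc dr] x0.
  apply: is_derive_eq (is_deriveD (dc x0) (dr x0)) _.
  by case: (j == I k.*2); case: (j == _); case: (j) => [|j'] /=; ring.
have [|||||z0 sod] := @derivative_chain_eq0 R (fun j => b (k + j) k \- b k (k + j))
    (sigma k.*2.+1) 2 (I k.*2.+1).+1 m.
- by rewrite pnatr_eq0.
- by move=> j; apply: real_loc_abs_continuousB.
- by move=> j x mj x0; have [h1 h2] := farz j x mj x0; rewrite /= h1 h2 subr0.
- exact: sigma_integrable.
- move=> j; apply: ae_imply (ae_both (colk j) (rowk j)) => x [dc dr] x0.
  apply: is_derive_eq (is_deriveB (dc x0) (dr x0)) _.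
  by case: (j == I k.*2); case: (j == _); case: (j) => [|j'] /=; ring.
have bj0 j x : 0 < x -> b (k + j) k x = 0 /\ b k (k + j) x = 0.
  by move=> x0; have := y0 j x x0; have := z0 j x x0 => /=; split; lra.
split=> [r s x x0|nu].
  rewrite !ltnS => rs.
  have [rk|kr] := ltnP r k; first by apply: bk; rewrite // rk.
  have [sk'|ks] := ltnP s k; first by apply: bk; rewrite // sk' orbT.
  have [rk|sk'] : r = k \/ s = k by case/orP: rs => ?; [left|right]; lia.
    by rewrite rk -(subnKC ks); have [] := bj0 (s - k)%N x x0.
  by rewrite sk' -(subnKC kr); have [] := bj0 (r - k)%N x x0.
rewrite doubleS !ltnS leq_eqVlt => /orP[/eqP-> //|].
by rewrite ltnS leq_eqVlt => /orP[/eqP-> //|]; exact: sk.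
Qed.

Lemma total_derivative_eq0 :
  (forall r s x, 0 < x -> b r s x = 0) /\
  (forall nu, (nu < m.*2)%N ->
     {ae lebesgue_measure, forall x : R, 0 < x -> sigma nu x = 0}).
Proof.
have [b0 s0] : vanishes_upto m.
  have: (m <= m)%N by []; elim: {1 3}m => [|k IH] km; first by split.
  by apply: vanishes_step => //; apply: IH; exact: ltnW.
split=> // r s x x0; have [rm|mr] := ltnP r m; first by apply: b0; rewrite ?rm.
by apply: b_support; rewrite ?mr.
Qed.

End TotalDerivative.

(** * Entrywise form of the matrix equation *)

Section CompanionStructure.
Variables (K : comNzRingType) (n : nat).
Local Notation m := (n.+1)./2.
Implicit Types (Q : 'M[K]_m.+1) (M : 'M[K]_n.+1).

(** What [assoc_matrix] adds to the superdiagonal shift, with 0-based indices: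
    row [a] of the matrix corresponds to the index [n - a] of [Q]. *)
Definition tail_entry Q (a c : nat) : K :=
  let q (r s : nat) : K := Q (inord r) (inord s) in
  if odd n.+1 then
    if (m <= a)%N && (c <= m)%N then (-1) ^+ a.+1 * q c (n - a)%N else 0
  else
    if (a.+1 == m) && (c < m)%N then (-1) ^+ m.+1 * q c m
    else if (m <= a)%N && (c == m) then (-1) ^+ a * q m (n - a)%N
    else if (m <= a)%N && (c < m)%N then
      (-1) ^+ a * q c (n - a)%N + (-1) ^+ (m + a.+1) * q c m * q m (n - a)%N
    else 0.

Lemma assoc_matrixE Q (a c : nat) : (a <= n)%N -> (c <= n)%N ->
  assoc_matrix Q (inord a) (inord c) = (c == a.+1)%:R + tail_entry Q a c.
Proof.
move=> an cn; rewrite /assoc_matrix mxE !inordK // /tail_entry.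
have n2 := odd_double_half n.+1.
rewrite eqSS; have [ca|ca] := eqVneq c a.+1.
  rewrite [X in _ = _ + X](_ : _ = 0) ?addr0 //; subst c.
  case: ifP => o; first by case: ifP => // h; lia.
  by do 3 (case: ifP => [h|_]; first lia).
rewrite add0r; case: ifP => o.
  rewrite !ltnS; case: ifP => // h.
  by rewrite (_ : (2 * m).+1 - a.+1 = n - a)%N //; lia.
rewrite eqSS !ltnS; case: ifP => // h1; case: ifP => h2.
  by rewrite !exprS !mulrA !mulN1r !opprK mul1r (_ : 2 * m - a.+1 = n - a)%N //; lia.
case: ifP => // h3.
by rewrite !exprS !mulrA !mulN1r !opprK !mul1r (_ : 2 * m - a.+1 = n - a)%N //; lia.
Qed.

Lemma tail_entry_support Q (a c : nat) : (a < n - m)%N || (m < c)%N ->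
  tail_entry Q a c = 0.
Proof.
have n2 := odd_double_half n.+1.
rewrite /tail_entry => h; case: ifP => o; first by case: ifP => // ?; lia.
by do 3 (case: ifP => [?|_]; first lia).
Qed.

Lemma sum_nat_pick (F : nat -> K) (B : nat -> bool) (p : nat) : (p <= n)%N ->
  (forall l, B l = (l == p)) ->
  \sum_(l < n.+1) (B l)%:R * F l = F p.
Proof.
move=> pn Bp; rewrite (bigD1 (Ordinal (pn : (p < n.+1)%N))) //= Bp eqxx mul1r.
by rewrite big1 ?addr0 // => l lp; rewrite Bp (_ : (l == p :> nat) = false) ?mul0r //; exact: negPf.
Qed.

(** Multiplication by the shift moves rows up or columns right; it accounts for
    the first summand in this lemma and in the next one. *)
Lemma assoc_mulmx Q M (a c : nat) : (a <= n)%N -> (c <= n)%N ->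
  (assoc_matrix Q *m M) (inord a) (inord c) =
  (if (a < n)%N then M (inord a.+1) (inord c) else 0) +
  \sum_(l < n.+1) tail_entry Q a l * M (inord l) (inord c).
Proof.
move=> an cn; rewrite mxE.
have -> : (if (a < n)%N then M (inord a.+1) (inord c) else 0) =
    \sum_(l < n.+1) (l == a.+1 :> nat)%:R * M (inord l) (inord c).
  have [ltan|na] := ltnP a n.
    by rewrite (sum_nat_pick (fun l => M (inord l) (inord c)) (B := eqtype.eq_op^~ a.+1) ltan).
  by rewrite big1 // => l _; rewrite ltn_eqF ?mul0r // (leq_trans (ltn_ord l)).
rewrite -big_split; apply: eq_bigr => l _ /=.
by rewrite -mulrDl -assoc_matrixE ?inord_val // -ltnS.
Qed.

Lemma mulmx_assoc Q M (a c : nat) : (a <= n)%N -> (c <= n)%N ->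
  (M *m assoc_matrix Q) (inord a) (inord c) =
  (if c is c'.+1 then M (inord a) (inord c') else 0) +
  \sum_(l < n.+1) M (inord a) (inord l) * tail_entry Q l c.
Proof.
move=> an cn; rewrite mxE.
have -> : (if c is c'.+1 then M (inord a) (inord c') else 0) =
    \sum_(l < n.+1) (c == l.+1 :> nat)%:R * M (inord a) (inord l).
  case: c cn => [|c] cn.
    by rewrite big1 // => l _; rewrite mul0r.
  rewrite (sum_nat_pick (fun l => M (inord a) (inord l)) (B := fun l => c.+1 == l.+1) (ltnW cn)) //.
  by move=> l; rewrite eqSS eq_sym.
rewrite -big_split; apply: eq_bigr => l _ /=.
by rewrite [_%:R * _]mulrC -mulrDr -assoc_matrixE ?inord_val // -ltnS.
Qed.

(** Support in the lower left [m x m] block, for either parity of [n.+1]. *)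
Definition lower_block M : Prop :=
  forall a c, (a <= n)%N -> (c <= n)%N -> (a <= n - m)%N || (m <= c)%N ->
    M (inord a) (inord c) = 0.

(** The block and the tail of an associated matrix overlap in a single index of
    the product when the order is even, and in none when it is odd; the same
    holds for the product in the other order. *)
Lemma lower_block_mul_tail Q M (a c : nat) : lower_block M -> (a <= n)%N -> (c <= n)%N ->
  \sum_(l < n.+1) M (inord a) (inord l) * tail_entry Q l c =
  if odd n.+1 then 0 else M (inord a) (inord m.-1) * tail_entry Q m.-1 c.
Proof.
have n2 := odd_double_half n.+1.
move=> lbM an cn; case: ifP => o.
  rewrite big1 // => l _; have [lm|ml] := ltnP l m.
    by rewrite tail_entry_support ?mulr0 //; lia.
  by rewrite lbM ?mul0r ?ml ?orbT // -ltnS.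
have mn : (m.-1 < n.+1)%N by lia.
rewrite (bigD1 (Ordinal mn)) //= big1 ?addr0 // => l /eqP lm.
have {}lm : l <> m.-1 :> nat by move=> lm'; apply: lm; exact: val_inj.
have [lm1|ml] := ltnP l m.
  by rewrite tail_entry_support ?mulr0 //; lia.
by rewrite lbM ?mul0r ?ml ?orbT // -ltnS.
Qed.

Lemma tail_mul_lower_block Q M (a c : nat) : lower_block M -> (a <= n)%N -> (c <= n)%N ->
  \sum_(l < n.+1) tail_entry Q a l * M (inord l) (inord c) =
  if odd n.+1 then 0 else tail_entry Q a m * M (inord m) (inord c).
Proof.
have n2 := odd_double_half n.+1.
move=> lbM an cn; case: ifP => o.
  rewrite big1 // => l _; have [ml|lm] := ltnP m l.
    by rewrite tail_entry_support ?mul0r // ml orbT.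
  by rewrite lbM ?mulr0 //; lia.
have [m0|m0] := eqVneq m 0%N; first by lia.
have mn : (m < n.+1)%N by lia.
rewrite (bigD1 (Ordinal mn)) //= big1 ?addr0 // => l /eqP lm.
have {}lm : l <> m :> nat by move=> lm'; apply: lm; exact: val_inj.
have [ml|lm1] := ltnP m l.
  by rewrite tail_entry_support ?mul0r // ml orbT.
by rewrite lbM ?mulr0 //; lia.
Qed.

Lemma signr_double_sub s : (s <= m.*2)%N -> (-1) ^+ (m.*2 - s) = (-1) ^+ s :> K.
Proof. by move=> sm; rewrite -signr_odd oddB // odd_double signr_odd. Qed.

Lemma solve_first (d t' x t y : K) : d + t' + x = t + y -> d = t + y - x - t'.
Proof. by move=> <-; ring. Qed.

Lemma solve_entry (d t' x u t y v : K) :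
  d + t' + x + u = t + y + v -> d = t + y + v - u - x - t'.
Proof. by move=> <-; ring. Qed.

Lemma solve_last (a b c : K) : a = b + c -> c = a - b.
Proof. by move=> ->; ring. Qed.

Lemma sign_cancel_top (f q : K) : f * f = 1 -> f * 0 = - q - f * 0 - - (f * (f * q)).
Proof. by move=> ff; rewrite [f * (f * q)]mulrA ff; ring. Qed.

Lemma sign_cancel_col (e q : K) : e * e = 1 -> e * 0 = - q - e * (- e * q) - - (e * 0).
Proof. by move=> ee; rewrite [e * (- e * q)]mulrA mulrN ee; ring. Qed.

(** For odd order this is the matrix equation read entry by entry.  For even
    order, the equations on the row [m.-1] and the column [m] bordering the
    block have no derivative and express the first row and the last column of
    the block by [Q - Q'] ([Etop], [Ecol]): they are the equations for [s = m]
    and [r = m].  Substituted into the interior equations, these values cancel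
    the quadratic terms of the associated matrices. *)
Lemma reduced_system Q Q' (P dP : 'M[K]_n.+1) (r s : nat) :
  (0 < n)%N -> lower_block (P - 1%:M) -> lower_block dP ->
  dP + P *m assoc_matrix Q' = assoc_matrix Q *m P ->
  Q (inord m) (inord m) = Q' (inord m) (inord m) ->
  (r <= m)%N -> (s <= m)%N ->
  let beta r s := (-1) ^+ s * (P - 1%:M) (inord (n - s)) (inord r) in
  (-1) ^+ s * dP (inord (n - s)) (inord r) =
  - (Q (inord r) (inord s) - Q' (inord r) (inord s))
  - (if r is r'.+1 then beta r' s else 0) - (if s is s'.+1 then beta r s' else 0).
Proof.
have n2 := odd_double_half n.+1.
move=> n0 lbE lbd eqM Qm rm sm; set E := P - 1%:M in lbE *.
have PE : P = 1%:M + E by rewrite addrC subrK.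
clearbody E; cbv beta zeta.
have Ez a c : (a <= n)%N -> (c <= n)%N -> (a <= n - m)%N || (m <= c)%N ->
  E (inord a) (inord c) = 0 by exact: lbE.
have addE (A B : 'M[K]_n.+1) i j : (A + B) i j = A i j + B i j by rewrite mxE.
have eqE a c : (a <= n)%N -> (c <= n)%N ->
    dP (inord a) (inord c) + tail_entry Q' a c +
      (if c is c'.+1 then E (inord a) (inord c') else 0) +
      (if odd n.+1 then 0 else E (inord a) (inord m.-1) * tail_entry Q' m.-1 c) =
    tail_entry Q a c + (if (a < n)%N then E (inord a.+1) (inord c) else 0) +
      (if odd n.+1 then 0 else tail_entry Q a m * E (inord m) (inord c)).
  move=> an cn.
  have := congr1 (fun M : 'M[K]_n.+1 => M (inord a) (inord c)) eqM.
  rewrite PE mulmxDl mulmxDr mul1mx mulmx1 !addE.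
  rewrite mulmx_assoc // assoc_mulmx // !assoc_matrixE //.
  rewrite lower_block_mul_tail // tail_mul_lower_block //.
  rewrite -!addrA => h; apply: (@addrI _ (c == a.+1)%:R).
  by rewrite [LHS]addrCA; exact: h.
have an : (n - s <= n)%N := leq_subr _ _.
have rn : (r <= n)%N by lia.
have ee : (-1) ^+ s * (-1) ^+ s = 1 :> K by rewrite -expr2 sqrr_sign.
have ff : (-1) ^+ m * (-1) ^+ m = 1 :> K by rewrite -expr2 sqrr_sign.
pose X := if r is r'.+1 then E (inord (n - s)) (inord r') else 0.
pose Y := if (n - s < n)%N then E (inord (n - s).+1) (inord r) else 0.
have -> : (if r is r'.+1 then (-1) ^+ s * E (inord (n - s)) (inord r') else 0) =
    (-1) ^+ s * X.
  by rewrite /X; case: (r) => //; rewrite mulr0.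
have -> : (if s is s'.+1 then (-1) ^+ s' * E (inord (n - s')) (inord r) else 0) =
    - ((-1) ^+ s * Y).
  rewrite /Y; case: (s) sm => [|s'] sm'; first by rewrite subn0 ltnn mulr0 oppr0.
  rewrite ifT; last by lia.
  by rewrite (_ : (n - s'.+1).+1 = n - s')%N ?exprS ?mulN1r ?mulNr ?opprK //; lia.
have := eqE (n - s)%N r an rn; rewrite -/X -/Y.
case: (boolP (odd n.+1)) => o.
  rewrite !addr0 /tail_entry o rm.
  have -> : (m <= n - s)%N by lia.
  have -> : (-1) ^+ (n - s).+1 = - (-1) ^+ s :> K.
    by rewrite exprS mulN1r -(signr_double_sub (leq_trans sm _)) 1?(_ : m.*2 = n) //; lia.
  rewrite subKn /=; last by lia.
  set e := (-1) ^+ s in ee * => h.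
  have -> : dP (inord (n - s)) (inord r) = - e * Q (inord r) (inord s) + Y -
      X + e * Q' (inord r) (inord s).
    by rewrite (solve_first h); ring.
  transitivity (- (e * e * (Q (inord r) (inord s) - Q' (inord r) (inord s))) - e * X + e * Y).
    ring.
  by rewrite ee mul1r opprK.
have tail_top q c : (c < m)%N ->
    tail_entry q m.-1 c = - (-1) ^+ m * q (inord c) (inord m).
  move=> cm; rewrite /tail_entry (negPf o).
  by rewrite ifT ?exprS ?mulN1r //; lia.
have tail_top0 q : tail_entry q m.-1 m = 0.
  by rewrite /tail_entry (negPf o) !ifF //; lia.
have sgn : (s < m)%N -> (-1) ^+ (n - s) = - (-1) ^+ s :> K.
  move=> sltm; rewrite -(signr_double_sub (leq_trans sm _)); last by lia.
  by rewrite (_ : m.*2 - s = (n - s).+1)%N ?exprS ?mulN1r ?opprK //; lia.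
have tail_col q : (s < m)%N ->
    tail_entry q (n - s) m = - (-1) ^+ s * q (inord m) (inord s).
  move=> sltm; rewrite /tail_entry (negPf o) ltnn andbF ifT; last by lia.
  by rewrite sgn // subKn //; lia.
have tail_in q : (s < m)%N -> (r < m)%N ->
    tail_entry q (n - s) r = - (-1) ^+ s * q (inord r) (inord s) +
      (-1) ^+ m * (-1) ^+ s * q (inord r) (inord m) * q (inord m) (inord s).
  move=> sltm rltm; rewrite /tail_entry (negPf o) ifF; last by lia.
  rewrite ifF; last by lia.
  rewrite ifT; last by lia.
  rewrite subKn; last by lia.
  by rewrite exprD exprS sgn // mulrNN mul1r.
have Etop : (r < m)%N -> E (inord m) (inord r) =
    (-1) ^+ m * (Q (inord r) (inord m) - Q' (inord r) (inord m)).
  move=> rltm; have := eqE m.-1 r; rewrite (negPf o) !tail_top0 mul0r !tail_top //.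
  rewrite (Ez m.-1 m.-1) ?mul0r ?addr0; [|lia|lia|lia].
  rewrite lbd; [|lia|lia|lia].
  rewrite add0r (_ : match r with 0 => 0 | r'.+1 => _ end = 0); last first.
    by case: (r) rltm => // r' ?; apply: Ez; lia.
  rewrite addr0; have -> : (m.-1 < n)%N by lia.
  have -> : m.-1.+1 = m by lia.
  by move=> h; rewrite (solve_last (h _ _)) //; [ring|lia].
have Ecol : (s < m)%N -> E (inord (n - s)) (inord m.-1) =
    - (-1) ^+ s * (Q (inord m) (inord s) - Q' (inord m) (inord s)).
  move=> sltm; have := eqE (n - s)%N m; rewrite (negPf o) !tail_top0 mulr0 !addr0.
  rewrite lbd ?leqnn ?orbT //; last by lia.
  rewrite (Ez m m) ?mulr0 ?addr0 ?add0r; [|lia|lia|lia].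
  rewrite (_ : (if (_ < n)%N then _ else 0) = 0) ?addr0; last first.
    by case: ifP => // ?; apply: Ez; lia.
  rewrite (_ : match m with 0 => 0 | c'.+1 => _ end = E (inord (n - s)) (inord m.-1)); last first.
    by have : (0 < m)%N by [lia]; case: (m).
  by rewrite !tail_col // => h; rewrite (solve_last (esym (h _ _))) //; [ring|lia].
move=> h; have {h} : dP (inord (n - s)) (inord r) + tail_entry Q' (n - s) r + X +
    E (inord (n - s)) (inord m.-1) * tail_entry Q' m.-1 r =
    tail_entry Q (n - s) r + Y + tail_entry Q (n - s) m * E (inord m) (inord r) := h.
have [rltm|mr] := ltnP r m; have [sltm|ms] := ltnP s m.
- rewrite !tail_in // tail_top // tail_col // Etop // Ecol //.
  set e := (-1) ^+ s in ee *; set f := (-1) ^+ m in ff * => /solve_entry ->.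
  rewrite -[Q (inord r) (inord s) - _]mul1r -ee; ring.
- have {ms} es : s = m by apply/eqP; rewrite eqn_leq sm.
  subst s => _; rewrite lbd; [|lia|lia|lia].
  have -> : X = 0 by rewrite /X; case: (r) rltm => // r' ?; apply: Ez; lia.
  have -> : Y = (-1) ^+ m * (Q (inord r) (inord m) - Q' (inord r) (inord m)).
    rewrite -Etop // /Y; have -> : (n - m < n)%N by lia.
    by have -> : ((n - m).+1 = m)%N by lia.
  exact: sign_cancel_top.
- have {mr} er : r = m by apply/eqP; rewrite eqn_leq rm.
  subst r => _; rewrite lbd; [|lia|lia|lia].
  have -> : X = - (-1) ^+ s * (Q (inord m) (inord s) - Q' (inord m) (inord s)).
    by rewrite -Ecol // /X; have : (0 < m)%N by [lia]; case: (m).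
  have -> : Y = 0 by rewrite /Y; case: ifP => // ?; apply: Ez; lia.
  exact: sign_cancel_col.
- have {ms} es : s = m by apply/eqP; rewrite eqn_leq sm.
  have {mr} er : r = m by apply/eqP; rewrite eqn_leq rm.
  subst r s => _; rewrite lbd; [|lia|lia|lia].
  have -> : X = 0.
    have EX : E (inord (n - m)) (inord m.-1) = 0 by apply: Ez; lia.
    by rewrite -EX /X; have : (0 < m)%N by [lia]; case: (m).
  have -> : Y = 0 by rewrite /Y; case: ifP => // ?; apply: Ez; lia.
  by rewrite Qm subrr !mulr0 !oppr0 !addr0.
Qed.

(** In row [a], above the tail, the equation reads
    [dP_(a,c) + P_(a,c-1) = P_(a+1,c)]. *)
Lemma row_step Q Q' (P dP : 'M[K]_n.+1) (a : nat) : (a < n - m)%N ->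
  dP + P *m assoc_matrix Q' = assoc_matrix Q *m P ->
  (forall c, (c <= n)%N -> P (inord a) (inord c) = (a == c)%:R) ->
  (forall c, (c <= n)%N -> dP (inord a) (inord c) = 0) ->
  forall c, (c <= n)%N -> P (inord a.+1) (inord c) = (a.+1 == c)%:R.
Proof.
move=> anm eqM Pa dPa c cn; have an : (a <= n)%N by lia.
have := congr1 (fun M : 'M[K]_n.+1 => M (inord a) (inord c)) eqM.
rewrite /= [X in X = _ -> _]mxE dPa // add0r mulmx_assoc // assoc_mulmx //.
rewrite [X in _ + X = _]big1 => [|l _]; last first.
  rewrite Pa -1?ltnS //; case: eqP => [al|_]; last by rewrite mul0r.
  by rewrite -al tail_entry_support ?mulr0 ?anm.
rewrite [X in _ = _ + X]big1 => [|l _]; last first.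
  by rewrite tail_entry_support ?mul0r ?anm.
rewrite !addr0 ifT; last by lia.
by move=> <-; case: c cn => // c cn; rewrite Pa // ltnW.
Qed.

(** In column [c + 1], to the right of the tail, the equation reads
    [dP_(a,c+1) + P_(a,c) = P_(a+1,c+1)]. *)
Lemma col_step Q Q' (P dP : 'M[K]_n.+1) (c : nat) : (m <= c)%N -> (c < n)%N ->
  dP + P *m assoc_matrix Q' = assoc_matrix Q *m P ->
  (forall a, (a <= n)%N -> P (inord a) (inord c.+1) = (a == c.+1)%:R) ->
  (forall a, (a <= n)%N -> dP (inord a) (inord c.+1) = 0) ->
  forall a, (a <= n)%N -> P (inord a) (inord c) = (a == c)%:R.
Proof.
move=> mc cn eqM Pc dPc a an.
have := congr1 (fun M : 'M[K]_n.+1 => M (inord a) (inord c.+1)) eqM.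
rewrite /= [X in X = _ -> _]mxE dPc // add0r mulmx_assoc // assoc_mulmx //.
rewrite [X in _ + X = _]big1 => [|l _]; last first.
  by rewrite tail_entry_support ?mulr0 // ltnS mc orbT.
rewrite [X in _ = _ + X]big1 => [|l _]; last first.
  rewrite Pc -1?ltnS //; case: eqP => [->|_]; last by rewrite mulr0.
  by rewrite tail_entry_support ?mul0r // ltnS mc orbT.
rewrite !addr0 => ->; case: ltnP => [ltan|na]; first by rewrite Pc.
by rewrite gtn_eqF // (leq_trans cn).
Qed.

End CompanionStructure.

(** * Real and imaginary parts *)

Section ComplexParts.
Variable R : realType.
Implicit Types (f : R -> R[i]) (x : R).

Lemma le_Re_normc (z : R[i]) : `|complex.Re z| <= ComplexField.Normc.normc z.
Proof. by case: z => a b /=; rewrite -sqrtr_sqr ler_sqrt ?lerDl ?addr_ge0 ?sqr_ge0. Qed.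

Lemma le_Im_normc (z : R[i]) : `|complex.Im z| <= ComplexField.Normc.normc z.
Proof. by case: z => a b /=; rewrite -sqrtr_sqr ler_sqrt ?lerDr ?addr_ge0 ?sqr_ge0. Qed.

Lemma Re_is_sub (z w : R[i]) : complex.Re (z - w) = complex.Re z - complex.Re w.
Proof. by case: z; case: w. Qed.

Lemma Im_is_sub (z w : R[i]) : complex.Im (z - w) = complex.Im z - complex.Im w.
Proof. by case: z; case: w. Qed.

Lemma Re_scale (r : R) (z : R[i]) : complex.Re (r%:C * z) = r * complex.Re z.
Proof. by case: z => a b /=; rewrite mul0r subr0. Qed.

Lemma Im_scale (r : R) (z : R[i]) : complex.Im (r%:C * z) = r * complex.Im z.
Proof. by case: z => a b /=; rewrite mul0r addr0. Qed.

(** The properties shared by [Re] and [Im] that the argument uses, so that it is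
    carried out once for both. *)
Definition real_coordinate (proj : R[i] -> R) : Prop :=
  [/\ forall z w, proj (z - w) = proj z - proj w,
      forall (r : R) z, proj (r%:C * z) = r * proj z,
      forall z, `|proj z| <= ComplexField.Normc.normc z,
      forall f x v, is_cderive f x v -> is_derive x 1 (proj \o f) (proj v) &
      forall f, measurable_fun (`]0, +oo[ : set R) (fun x : R => complex.Re (f x)) ->
        measurable_fun (`]0, +oo[ : set R) (fun x : R => complex.Im (f x)) ->
        measurable_fun (`]0, +oo[ : set R) (proj \o f)].

Lemma real_coordinate_Re : real_coordinate (@complex.Re R).
Proof.
by split; [exact: Re_is_sub|exact: Re_scale|exact: le_Re_normc|move=> ? ? ? []|].
Qed.

Lemma real_coordinate_Im : real_coordinate (@complex.Im R).
Proof.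
by split; [exact: Im_is_sub|exact: Im_scale|exact: le_Im_normc|move=> ? ? ? []|].
Qed.

Lemma complex_eq_coord (z w : R[i]) :
  (forall proj, real_coordinate proj -> proj z = proj w) -> z = w.
Proof.
move=> h; apply/eqP; rewrite eq_complex; apply/andP; split; apply/eqP; apply: h.
  exact: real_coordinate_Re.
exact: real_coordinate_Im.
Qed.

Section Coordinate.
Variable proj : R[i] -> R.
Hypothesis projP : real_coordinate proj.

Lemma proj0 : proj 0 = 0.
Proof. by have [pB _ _ _ _] := projP; rewrite -(subrr 0) pB subrr. Qed.

Lemma projN z : proj (- z) = - proj z.
Proof. by have [pB _ _ _ _] := projP; rewrite -sub0r pB proj0 sub0r. Qed.

Lemma projD z w : proj (z + w) = proj z + proj w.
Proof. by have [pB _ _ _ _] := projP; rewrite -{1}(opprK w) pB projN opprK. Qed.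

Lemma proj_sum (I : Type) (r : seq I) (P : pred I) (F : I -> R[i]) :
  proj (\sum_(i <- r | P i) F i) = \sum_(i <- r | P i) proj (F i).
Proof. by elim/big_rec2: _ => [|i a b _ <-]; [exact: proj0|exact: projD]. Qed.

Lemma proj_sign (k : nat) z : proj ((-1) ^+ k * z) = (-1) ^+ k * proj z.
Proof.
rewrite -signr_odd -[in RHS]signr_odd; case: (odd k); last by rewrite !mul1r.
by rewrite !mulN1r projN.
Qed.

Lemma real_loc_abs_continuous_proj f :
  loc_abs_continuous_Rplus f -> real_loc_abs_continuous (proj \o f).
Proof.
have [pB _ le_normc _ _] := projP.
move=> lf c d c0 cd e e0; have [delta d0 fd] := lf c d c0 cd e e0.
exists delta => // N a b abcd tr /(fd _ _ _ abcd tr); apply: le_lt_trans.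
by apply: ler_sum => i _; rewrite /= -pB.
Qed.

Lemma integrable_proj f : in_Lp_Rplus 1 f -> integrable_Rplus (proj \o f).
Proof.
have [_ _ le_normc _ mproj] := projP.
case=> mRe mIm fin; apply/integrableP; split.
  by apply/measurable_EFinP; exact: mproj.
apply: le_lt_trans fin.
apply: ge0_le_integral => //.
- by apply: measurableT_comp => //; apply/measurable_EFinP; exact: mproj.
- apply/measurable_EFinP.
  rewrite (_ : (fun x => _) = Num.sqrt \o
    (fun x => complex.Re (f x) ^+ 2 + complex.Im (f x) ^+ 2)).
    apply: measurableT_comp.
      by apply: continuous_measurable_fun; exact: sqrt_continuous.
    by apply: measurable_funD; apply: measurable_funX.
  by apply/funext => x /=; rewrite expr1; case: (f x).
- by move=> x _; rewrite /= lee_fin expr1; exact: le_normc.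
Qed.

End Coordinate.

Lemma complex_ae_const f (v : R[i]) : loc_abs_continuous_Rplus f ->
  {ae lebesgue_measure, forall x : R, 0 < x -> f x = v} ->
  forall x, 0 < x -> f x = v.
Proof.
move=> lf fv x x0; apply: complex_eq_coord => proj projP.
apply: (real_loc_abs_continuous_ae_const (real_loc_abs_continuous_proj projP lf)) => //.
by apply: ae_imply fv => y fy y0; rewrite /= fy.
Qed.

Lemma is_cderive_const f (v d : R[i]) x : (forall y, 0 < y -> f y = v) -> 0 < x ->
  is_cderive f x d -> d = 0.
Proof.
move=> fv x0 df; apply: complex_eq_coord => proj projP; rewrite proj0 //.
have [_ _ _ pd _] := projP; have [_ <-] := pd _ _ _ df.
have h y : 0 < y -> (proj \o f) y = proj v by move=> y0; rewrite /= fv.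
by have [_ ->] := is_derive_half_line_cst h x0.
Qed.

End ComplexParts.

(** * Reduction of the matrix equation to the bilinear form *)

Lemma chi_entry_real (R : rcfType) (nu i r s : nat) :
  chi_entry R[i] nu i r s = (chi_entry R nu i r s)%:C.
Proof.
rewrite /chi_entry; case: ifP => _; case: ifP => _; rewrite ?rmorph0 //.
  by rewrite rmorphB rmorphM !rmorph_nat.
by rewrite rmorph_nat.
Qed.

(** Since [nu - nu./2 = uphalf nu], this is the common form of the bounds for
    even and odd [nu]: the form of index [nu] involves derivatives of order at
    most [N./2]. *)
Lemma singularity_order_bound (N : nat) (I : 'I_N.-1 -> nat) (nu : 'I_N.-1) :
  singularity_orders I -> (I nu + uphalf nu <= N./2)%N.
Proof.
move=> /(_ nu); have := odd_double_half N; have := odd_double_half nu.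
have := ltn_ord nu; rewrite uphalf_half; case: (odd nu); lia.
Qed.

Section Reduction.
Variables (R : realType) (n : nat).
Hypothesis n0 : (0 < n)%N.
Local Notation m := (n.+1)./2.
Variables (I : 'I_n.+1.-1 -> nat) (sigma sigma' : 'I_n.+1.-1 -> R -> R[i]).
Hypothesis hI : singularity_orders I.

Lemma Qmatrix_entry (s : 'I_n.+1.-1 -> R -> R[i]) (x : R) (r c : nat) :
  (r <= m)%N -> (c <= m)%N ->
  Qmatrix I s x (inord r) (inord c) =
  \sum_(nu < n.+1.-1) s nu x * chi_entry R[i] nu (I nu) r c.
Proof.
move=> rm cm; rewrite /Qmatrix summxE; apply: eq_bigr => nu _.
by rewrite mxE chiE !inordK.
Qed.

(** The total order [2m] of the corner exceeds [i_nu + nu] for every [nu]. *)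
Lemma Qmatrix_corner (s : 'I_n.+1.-1 -> R -> R[i]) (x : R) :
  Qmatrix I s x (inord m) (inord m) = 0.
Proof.
rewrite Qmatrix_entry // big1 // => nu _.
rewrite chi_entry_support ?mulr0 //; apply/negP => /and3P[h1 h2 /eqP h3].
have := singularity_order_bound nu hI; have := ltn_ord nu.
have := odd_double_half nu; have := odd_double_half n.+1; rewrite uphalf_half /=; lia.
Qed.

(** Extended by zero beyond the last index: for even [n.+1] the pair
    [sigma_(2k), sigma_(2k+1)] with [k = m - 1] is incomplete. *)
Definition coef_diff (proj : R[i] -> R) (nu : nat) (x : R) : R :=
  if insub nu is Some i then proj (sigma i x - sigma' i x) else 0.

Definition order_ext (nu : nat) : nat := if insub nu is Some i then I i else 0%N.

Lemma order_ext_bound nu : (nu < m.*2)%N -> (order_ext nu + uphalf nu <= m)%N.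
Proof.
rewrite /order_ext; case: insubP => [i _ <- _|_ num].
  exact: singularity_order_bound.
by rewrite add0n uphalf_half; have := odd_double_half nu; lia.
Qed.

Lemma proj_Qmatrix_diff (proj : R[i] -> R) (x : R) (r c : nat) :
  real_coordinate proj -> (r <= m)%N -> (c <= m)%N ->
  proj (Qmatrix I sigma x (inord r) (inord c) - Qmatrix I sigma' x (inord r) (inord c)) =
  form_coef m order_ext (coef_diff proj) r c x.
Proof.
move=> projP rm cm; have [_ pZ _ _ _] := projP.
rewrite !Qmatrix_entry // -sumrB proj_sum // /form_coef.
have n2 := odd_double_half n.+1.
rewrite (@big_cat_nat _ _ _ n) //=; last by lia.
rewrite [X in _ = _ + X]big_nat [X in _ = _ + X]big1 => [|nu /andP[nnu _]]; last first.
  rewrite /coef_diff; case: insubP => [i|]; rewrite ?mul0r //=.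
  by rewrite ltnNge nnu.
rewrite addr0 big_mkord; apply: eq_bigr => nu _.
rewrite /coef_diff /order_ext valK -mulrBl chi_entry_real mulrC pZ.
by rewrite mulrC.
Qed.

Variable P : R -> 'M[R[i]]_n.+1.
Hypothesis hPunit : forall x : R, 0 < x -> unit_lower_triangular (P x).
Hypothesis hPac : forall k j, loc_abs_continuous_Rplus (fun x => P x k j).
Hypothesis hPeq : {ae lebesgue_measure, forall x : R, 0 < x ->
  exists2 P' : 'M[R[i]]_n.+1,
    (forall k j, is_cderive (fun y => P y k j) x (P' k j)) &
    P' + P x *m Fmatrix I sigma' x = Fmatrix I sigma x *m P x}.

Lemma unit_lower_entry x (a c : nat) : 0 < x -> (a <= n)%N -> (c <= n)%N ->
  (a <= c)%N -> P x (inord a) (inord c) = (a == c)%:R.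
Proof.
move=> x0 an cn ac; have /andP[/is_trig_mxP tr /forallP diag] := hPunit x0.
have [->|ne] := eqVneq a c; first exact/eqP/diag.
by rewrite tr // !inordK // ltn_neqAle ne.
Qed.

(** Row [a] being constant, its derivative drops out of the equation, which gives
    row [a + 1] almost everywhere, hence everywhere by continuity. *)
Lemma top_rows a : (a <= n - m)%N -> forall c, (c <= n)%N -> forall x, 0 < x ->
  P x (inord a) (inord c) = (a == c)%:R.
Proof.
elim: a => [|a IH] anm c cn; first by move=> x x0; apply: unit_lower_entry.
apply: complex_ae_const; first exact: hPac.
apply: ae_imply hPeq => x eqx x0; have [dP dPx eqM] := eqx x0.
apply: (row_step _ eqM) => // [c' c'n|c' c'n].
  by apply: IH => //; exact: ltnW.
by apply: is_cderive_const x0 (dPx _ _); apply: IH => //; exact: ltnW.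
Qed.

(** The same propagation, by columns from the last one to column [m]. *)
Lemma right_cols c : (m <= c)%N -> (c <= n)%N -> forall a, (a <= n)%N -> forall x, 0 < x ->
  P x (inord a) (inord c) = (a == c)%:R.
Proof.
move=> mc cn; rewrite -(subKn cn); have : (n - c <= n - m)%N by lia.
elim: (n - c)%N => [|k IH] knm a an.
  by rewrite subn0 => x x0; apply: unit_lower_entry.
apply: complex_ae_const; first exact: hPac.
have nk : (n - k.+1).+1 = (n - k)%N by lia.
apply: ae_imply hPeq => x eqx x0; have [dP dPx eqM] := eqx x0.
apply: (col_step _ _ eqM) => //; rewrite ?nk; try lia.
  by move=> a' a'n; apply: IH => //; exact: ltnW.
move=> a' a'n; apply: is_cderive_const x0 (dPx _ _); apply: IH => //; exact: ltnW.
Qed.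

Lemma trivial_entry x (a c : nat) : 0 < x -> (a <= n)%N -> (c <= n)%N ->
  (a <= n - m)%N || (m <= c)%N -> P x (inord a) (inord c) = (a == c)%:R.
Proof. by move=> x0 an cn /orP[h|h]; [exact: top_rows|exact: right_cols]. Qed.

Lemma sub1_entry x (a c : nat) : (a <= n)%N -> (c <= n)%N ->
  (P x - 1%:M) (inord a) (inord c) = P x (inord a) (inord c) - (a == c)%:R.
Proof. by move=> an cn; rewrite !mxE -val_eqE /= !inordK. Qed.

(** Up to sign, the coefficients of the bilinear form of which the form of
    [Q - Q'] is the derivative, that is, of the boundary terms of an integration
    by parts. *)
Definition boundary_form (proj : R[i] -> R) (r s : nat) (x : R) : R :=
  if (r < m)%N && (s < m)%N then
    (-1) ^+ s * proj (P x (inord (n - s)) (inord r)) else 0.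

Lemma boundary_formE proj r s x : real_coordinate proj -> 0 < x ->
  (r <= m)%N -> (s <= m)%N ->
  boundary_form proj r s x =
  proj ((-1) ^+ s * (P x - 1%:M) (inord (n - s)) (inord r)).
Proof.
have n2 := odd_double_half n.+1.
move=> projP x0 rm sm; rewrite sub1_entry; [|lia|lia].
rewrite /boundary_form; case: ifP => h.
  have -> : (n - s)%N == r = false by lia.
  by rewrite subr0 proj_sign.
by rewrite trivial_entry ?subrr ?mulr0 ?proj0 //; lia.
Qed.

Lemma boundary_system proj r s : real_coordinate proj -> (r <= m)%N -> (s <= m)%N ->
  {ae lebesgue_measure, forall x : R, 0 < x ->
    is_derive x 1 (boundary_form proj r s)
      (- form_coef m order_ext (coef_diff proj) r s x
       - pred_row (boundary_form proj) r s x - pred_col (boundary_form proj) r s x)}.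
Proof.
have n2 := odd_double_half n.+1.
move=> projP rm sm; have [pB _ _ pd _] := projP.
apply: ae_imply hPeq => x eqx x0; have [dP dPx eqM] := eqx x0.
have lbE : lower_block (P x - 1%:M).
  by move=> a c an cn h; rewrite sub1_entry // trivial_entry // subrr.
have lbd : lower_block dP.
  move=> a c an cn h; apply: is_cderive_const x0 (dPx _ _) => y y0.
  exact: trivial_entry.
have Qm : Qmatrix I sigma x (inord m) (inord m) = Qmatrix I sigma' x (inord m) (inord m).
  by rewrite !Qmatrix_corner.
have /(congr1 proj) := reduced_system n0 lbE lbd eqM Qm rm sm.
rewrite /= !pB projN // proj_Qmatrix_diff //.
rewrite [X in _ = _ - X - _](_ : _ = pred_row (boundary_form proj) r s x); last first.
  by rewrite /pred_row; case: (r) rm => [|r'] rm; [exact: proj0|rewrite boundary_formE // ltnW].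
rewrite [X in _ = _ - X](_ : _ = pred_col (boundary_form proj) r s x); last first.
  by rewrite /pred_col; case: (s) sm => [|s'] sm; [exact: proj0|rewrite boundary_formE // ltnW].
move=> <-; rewrite proj_sign //.
rewrite /boundary_form; case h : ((r < m)%N && (s < m)%N).
  by apply: is_deriveZ; apply: pd.
rewrite lbd ?proj0 ?mulr0 //; try lia.
exact: is_derive_cst.
Qed.

Lemma boundary_ac proj r s : real_coordinate proj ->
  real_loc_abs_continuous (boundary_form proj r s).
Proof.
move=> projP; rewrite /boundary_form.
case: ((r < m)%N && (s < m)%N); last first.
  move=> c d _ _; apply: (@real_abs_continuous_lipschitz _ _ _ _ 1) => // x y _ _.
  by rewrite subrr normr0 mulr_ge0.
have acP := real_loc_abs_continuous_proj projP (hPac (inord (n - s)) (inord r)).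
rewrite -signr_odd; case: (odd s) => c d c0 cd.
  have := real_abs_continuousN (acP c d c0 cd); congr real_abs_continuous_on.
  by apply/funext => x; rewrite mulN1r.
have := acP c d c0 cd; congr real_abs_continuous_on.
by apply/funext => x; rewrite mul1r.
Qed.

Hypothesis hsigma : forall nu, in_Lp_Rplus 1 (sigma nu).
Hypothesis hsigma' : forall nu, in_Lp_Rplus 1 (sigma' nu).

Lemma coef_diff_integrable proj nu : real_coordinate proj ->
  integrable_Rplus (coef_diff proj nu).
Proof.
move=> projP; rewrite /coef_diff; case: insubP => [i _ _|_]; last exact: integrable0.
have [pB _ _ _ _] := projP.
rewrite /integrable_Rplus (_ : EFin \o _ =
  (fun x => (EFin \o (proj \o sigma i)) x - (EFin \o (proj \o sigma' i)) x)%E).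
  apply: integrableB; first exact: measurable_itv.
    exact: (integrable_proj projP (hsigma i)).
  exact: (integrable_proj projP (hsigma' i)).
by apply/funext => x /=; rewrite pB EFinB.
Qed.

Lemma boundary_form_support proj r s x : 0 < x -> (m <= r)%N || (m <= s)%N ->
  boundary_form proj r s x = 0.
Proof. by move=> _ h; rewrite /boundary_form ifF //; lia. Qed.

Lemma coordinate_rigidity proj : real_coordinate proj ->
  (forall r s x, 0 < x -> boundary_form proj r s x = 0) /\
  (forall nu, (nu < m.*2)%N ->
     {ae lebesgue_measure, forall x : R, 0 < x -> coef_diff proj nu x = 0}).
Proof.
move=> projP; apply: (total_derivative_eq0 order_ext_bound).
- by move=> nu; exact: coef_diff_integrable.
- by move=> r s; exact: boundary_ac.
- by move=> r s; exact: boundary_form_support.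
- by move=> r s; exact: boundary_system.
Qed.

Lemma rigidity_succ :
  (forall x : R, 0 < x -> P x = 1%:M) /\
  (forall nu : 'I_n.+1.-1,
     {ae lebesgue_measure, forall x : R, 0 < x -> sigma nu x = sigma' nu x}).
Proof.
have n2 := odd_double_half n.+1.
split=> [x x0|nu].
  apply/matrixP => a c; rewrite -(inord_val a) -(inord_val c).
  have := ltn_ord a; have := ltn_ord c; move: (val a) (val c) => {}a {}c.
  rewrite !ltnS => cn an; rewrite mxE -val_eqE /= !inordK //.
  have [h|] := boolP ((a <= n - m)%N || (m <= c)%N); first exact: trivial_entry.
  rewrite negb_or -!ltnNge => /andP[ham hcm].
  have -> : (a == c) = false by lia.
  apply: complex_eq_coord => proj projP; rewrite proj0 //.
  have [b0 _] := coordinate_rigidity projP.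
  have := b0 c (n - a)%N x x0; rewrite /boundary_form ifT; last by lia.
  by rewrite subKn // => /eqP; rewrite mulf_eq0 signr_eq0 => /eqP.
have num : (nu < m.*2)%N by have /= := ltn_ord nu; lia.
have [_ sRe] := coordinate_rigidity (real_coordinate_Re R).
have [_ sIm] := coordinate_rigidity (real_coordinate_Im R).
apply: ae_imply (ae_both (sRe _ num) (sIm _ num)) => x [hR hI'] x0.
move: (hR x0) (hI' x0); rewrite /coef_diff valK => {}hR {}hI'.
apply/eqP; rewrite -subr_eq0 eq_complex; apply/andP; split; apply/eqP.
  exact: hR.
exact: hI'.
Qed.

End Reduction.

Theorem lemma2p3 (R : realType) (n : nat) (hn : (2 <= n)%N)
  (I : 'I_n.-1 -> nat) (hI : singularity_orders I)
  (sigma sigma' : 'I_n.-1 -> R -> R[i])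
  (hsigma : coefficients I sigma) (hsigma' : coefficients I sigma')
  (P : R -> 'M[R[i]]_n)
  (hPunit : forall x : R, 0 < x -> unit_lower_triangular (P x))
  (hPac : forall k j : 'I_n, loc_abs_continuous_Rplus (fun x => P x k j))
  (hPeq : {ae lebesgue_measure, forall x : R, 0 < x ->
     exists2 P' : 'M[R[i]]_n,
       (forall k j : 'I_n, is_cderive (fun y => P y k j) x (P' k j)) &
       P' + P x *m Fmatrix I sigma' x = Fmatrix I sigma x *m P x}) :
  (forall x : R, 0 < x -> P x = 1%:M) /\
  (forall nu : 'I_n.-1,
     {ae lebesgue_measure, forall x : R, 0 < x -> sigma nu x = sigma' nu x}).
Proof.
case: n hn I hI sigma sigma' hsigma hsigma' P hPunit hPac hPeq => [//|n] hn.
move=> I hI sigma sigma' [hsigma _] [hsigma' _] P hPunit hPac hPeq.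
exact: (rigidity_succ hn hI hPunit hPac hPeq hsigma hsigma').
Qed.
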